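(* Let $n$ be a positive integer. The space of all triples $(\ell_1,\ell_2,\ell_3)$ of projective lines in $\mathbb{RP}^n$ such that any line in the triple intersects the two others at distinct points is homotopy equivalent to the real partial flag variety $\mathrm{Flag}(1,2,3,\mathbb{R}^{n+1})$ consisting of partial flags of signature $(0,1,2,3,n+1)$ in $\mathbb{R}^{n+1}$.
   Context: Triples are ordered. The condition on a triple means that any two of the three lines are distinct and intersect, and the point where a line of the triple meets one of the other two differs from the point where it meets the remaining one. Projective lines in $\mathbb{RP}^n$ correspond to $2$-dimensional linear subspaces of $\mathbb{R}^{n+1}$, and the space of triples carries the subspace topology from the triple product of the Grassmannian of $2$-dimensional subspaces of $\mathbb{R}^{n+1}$. $\mathrm{Flag}(1,2,3,\mathbb{R}^{n+1})$ is the space (with its usual real topology) of sequences of linear subspaces $0=V_0\subset V_1\subset V_2\subset V_3\subset\mathbb{R}^{n+1}$ with $\dim V_i=i$ for $i=1,2,3$ (for $n=2$ one has $V_3=\mathbb{R}^3$, so these are complete flags in $\mathbb{R}^3$). *)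

(* Defs.v *)
From HB Require Import structures.
From mathcomp Require Import all_boot all_order all_algebra.
From mathcomp Require Import all_classical all_reals all_analysis.

Set Implicit Arguments.
Unset Strict Implicit.
Unset Printing Implicit Defensive.

Import Order.TTheory GRing.Theory Num.Theory.
Import numFieldNormedType.Exports.

Local Open Scope classical_set_scope.
Local Open Scope ring_scope.

(* The values of [H] outside [X * [0, 1]] are irrelevant: only the restriction
   of [H] to that subspace is required to be continuous. *)
Definition homotopic (R : realType) (X Y : topologicalType) (f g : X -> Y) :=
  exists H : X * R -> Y,
    [/\ {within [set: X] `*` `[0, 1], continuous H},
        forall x, H (x, 0) = f x
      & forall x, H (x, 1) = g x].

Definition homotopy_equivalent (R : realType) (X Y : topologicalType) :=
  exists (f : X -> Y) (g : Y -> X),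
    [/\ continuous f, continuous g,
        homotopic R (g \o f) id & homotopic R (f \o g) id].

Definition grassmannian (R : realType) (k m : nat) : Type :=
  {U : {vspace 'rV[R]_m} | \dim U == k}.

HB.instance Definition _ (R : realType) (k m : nat) :=
  SubChoice.on (grassmannian R k m).

(* Linearly independent k-tuples of vectors of R^m, stored as the rows of a
   matrix, with the subspace topology from 'M[R]_(k, m). *)
Definition frame (R : realType) (k m : nat) : topologicalType :=
  [set M : 'M[R]_(k, m) | row_free M].

Definition row_span (R : realType) (k m : nat) (M : 'M[R]_(k, m)) :
  {vspace 'rV[R]_m} := <<[seq row i M | i : 'I_k]>>%VS.

Lemma dim_row_span (R : realType) (k m : nat) (M : frame R k m) :
  \dim (row_span (\val M)) == k.
Proof.
case: M => M /= /set_mem /= freeM; rewrite /row_span.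
pose X := [tuple row i M | i < k].
have -> : [seq row i M | i : 'I_k] = X :> seq _ by [].
suff /eqP -> : free X by rewrite size_tuple.
apply/freeP => c c0 i.
suff /rowP/(_ i) : \row_j c j = 0 by rewrite !mxE.
apply: (row_free_inj freeM); rewrite mul0mx mulmx_sum_row -[RHS]c0.
apply: eq_bigr => j _; congr (_ *: _); first by rewrite mxE.
by rewrite -tnth_nth tnth_mktuple.
Qed.

Definition frame_span (R : realType) (k m : nat) (M : frame R k m) :
  grassmannian R k m := exist _ (row_span (\val M)) (dim_row_span M).

(* The topology of the Grassmannian is the quotient topology along the
   surjection [frame_span]. *)
Section GrassmannianTopology.
Variables (R : realType) (k m : nat).

Definition grassmannian_open : set_system (grassmannian R k m) :=
  [set A | open (@frame_span R k m @^-1` A)].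

Lemma grassmannian_openT : grassmannian_open setT.
Proof. by rewrite /grassmannian_open /= preimage_setT; exact: openT. Qed.

Lemma grassmannian_openI : setI_closed grassmannian_open.
Proof. by move=> A B; exact: openI. Qed.

Lemma grassmannian_open_bigU (I : Type) (f : I -> set (grassmannian R k m)) :
  (forall i, grassmannian_open (f i)) -> grassmannian_open (\bigcup_i f i).
Proof.
move=> fo; rewrite /grassmannian_open /= preimage_bigcup.
by apply: bigcup_open => i _; exact: fo.
Qed.

HB.instance Definition _ := isOpenTopological.Build (grassmannian R k m)
  grassmannian_openT grassmannian_openI grassmannian_open_bigU.

End GrassmannianTopology.

Definition flag123 (R : realType) (m : nat) : topologicalType :=
  [set V : grassmannian R 1 m * grassmannian R 2 m * grassmannian R 3 m |
    (val V.1.1 <= val V.1.2)%VS /\ (val V.1.2 <= val V.2)%VS].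

(* A projective line of RP^n is a 2-dimensional subspace of R^(n+1). Two
   distinct ones meet iff their intersection is nonzero; this intersection is
   then 1-dimensional, and is their common point. *)
Definition proj_line (R : realType) (n : nat) : topologicalType :=
  grassmannian R 2 n.+1.

Definition meet_properly (R : realType) (n : nat) (l a : proj_line R n) :=
  l <> a /\ (val l :&: val a)%VS <> 0%VS.

Definition meets_at_distinct_points (R : realType) (n : nat)
    (l a b : proj_line R n) :=
  [/\ meet_properly l a, meet_properly l b
    & (val l :&: val a)%VS <> (val l :&: val b)%VS].

Definition line_triples (R : realType) (n : nat) : topologicalType :=
  [set l : proj_line R n * proj_line R n * proj_line R n |
    [/\ meets_at_distinct_points l.1.1 l.1.2 l.2,
        meets_at_distinct_points l.1.2 l.1.1 l.2
      & meets_at_distinct_points l.2 l.1.1 l.1.2]].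

(* Main.v *)
(* The vertices of a triple of lines are three independent points L1, L2, L3,
   the three lines being L1 + L2, L1 + L3 and L2 + L3, so a triple is the same
   thing as an ordered triple of independent lines through the origin.  It is
   sent to the flag L1 <= L1 + L2 <= L1 + L2 + L3; conversely a flag is sent to
   its orthogonal frame of lines V1, V2 - V1, V3 - V2 (orthogonal differences).
   One composite is the identity and the other is Gram-Schmidt, which is undone
   continuously by applying 1 - s Q1 to L2 and 1 - s Q2 to L3, where Q1, Q2 are
   the orthogonal projections onto L1 and L1 + L2, and s goes from 1 to 0; this
   never changes the flag.  For continuity, the topology of the Grassmannian is
   shown to be the initial one for the map sending a subspace to the matrix of
   its orthogonal projection. *)
Require Import Defs.
From mathcomp Require Import all_boot all_order all_algebra.
From mathcomp Require Import all_classical all_reals all_analysis.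
From mathcomp Require Import zify.

Set Implicit Arguments.
Unset Strict Implicit.
Unset Printing Implicit Defensive.

Import Order.TTheory GRing.Theory Num.Theory.
Import numFieldNormedType.Exports.

Local Open Scope classical_set_scope.
Local Open Scope ring_scope.

(** * Orthogonal projections and row spaces *)

Section OrthogonalProjection.
Variable R : realType.

(** Positivity of the real dot product: if [v *m B *m B^T = 0], then [v *m B] has zero sum of
    squares, hence vanishes. *)
Lemma gram_unitmx k m (B : 'M[R]_(k, m)) : (B *m B^T \in unitmx) = row_free B.
Proof.
apply/idP/idP => [BBu | freeB].
  by apply: inj_row_free => v vB; rewrite -[v](mulmxK BBu) mulmxA vB !mul0mx.
rewrite -row_free_unit; apply: inj_row_free => v vBB0.
apply: (row_free_inj freeB); rewrite mul0mx.
have /matrixP/(_ 0 0) : (v *m B) *m (v *m B)^T = 0.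
  by rewrite trmx_mul mulmxA -(mulmxA v) vBB0 mul0mx.
rewrite !mxE => /eqP; rewrite psumr_eq0 => [/allP vB0|j _]; last first.
  by rewrite !mxE -expr2 sqr_ge0.
apply/rowP => j; have := vB0 j (mem_index_enum j).
by rewrite !mxE -expr2 sqrf_eq0 => /eqP.
Qed.

Lemma mem_row_span k m (A : 'M[R]_(k, m)) v :
  (v \in row_span A) = (v <= A)%MS.
Proof.
rewrite /row_span.
apply/idP/idP => [|/submxP[D ->]].
  have -> : [seq row i A | i : 'I_k] = [tuple row i A | i < k] :> seq _ by [].
  move/coord_span=> ->; apply: summx_sub => i _; apply: scalemx_sub.
  by rewrite -tnth_nth tnth_mktuple row_sub.
rewrite mulmx_sum_row; apply: memv_suml => i _; apply/memvZ/memv_span.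
exact: map_f (mem_enum _ _).
Qed.

Lemma row_span_leP k m (A : 'M[R]_(k, m)) (U : {vspace 'rV[R]_m}) :
  reflect (forall v, v *m A \in U) (row_span A <= U)%VS.
Proof.
apply: (iffP subvP) => [sAU v | sAU v]; last first.
  by rewrite mem_row_span => /submxP[D ->].
by apply: sAU; rewrite mem_row_span submxMl.
Qed.

Definition basis_mx m (U : {vspace 'rV[R]_m}) : 'M[R]_(\dim U, m) :=
  \matrix_i (vbasis U)`_i.

Lemma row_span_basis_mx m (U : {vspace 'rV[R]_m}) : row_span (basis_mx U) = U.
Proof.
rewrite /row_span -[RHS](span_basis (vbasisP U)); congr (<<_>>%VS).
apply: (@eq_from_nth _ 0); rewrite size_map size_enum_ord ?size_tuple// => i ilt.
rewrite (nth_map (Ordinal ilt)) ?size_enum_ord// rowK.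
by rewrite nth_enum_ord.
Qed.

Lemma mem_basis_mx m (U : {vspace 'rV[R]_m}) v :
  (v \in U) = (v <= basis_mx U)%MS.
Proof. by rewrite -mem_row_span row_span_basis_mx. Qed.

Definition frame_of k m (B : 'M[R]_(k, m)) (freeB : row_free B) : frame R k m :=
  exist _ B (mem_set freeB).

Lemma dim_row_span_rank k m (A : 'M[R]_(k, m)) : \dim (row_span A) = \rank A.
Proof.
suff -> : row_span A = row_span (row_base A).
  exact/eqP/(dim_row_span (frame_of (row_base_free A))).
by apply/vspaceP => v; rewrite !mem_row_span eq_row_base.
Qed.

Lemma basis_mx_free m (U : {vspace 'rV[R]_m}) : row_free (basis_mx U).
Proof. by rewrite /row_free -dim_row_span_rank row_span_basis_mx. Qed.

(** For [B] with independent rows, the orthogonal projection onto its row space, acting on row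
    vectors from the right. *)
Definition gram_proj k m (B : 'M[R]_(k, m)) : 'M[R]_m :=
  B^T *m invmx (B *m B^T) *m B.

Definition orthoproj m (U : {vspace 'rV[R]_m}) : 'M[R]_m := gram_proj (basis_mx U).

Lemma tr_orthoproj m (U : {vspace 'rV[R]_m}) : (orthoproj U)^T = orthoproj U.
Proof.
by rewrite /orthoproj /gram_proj !trmx_mul trmxK trmx_inv trmx_mul trmxK mulmxA.
Qed.

Lemma orthoproj_mem m (U : {vspace 'rV[R]_m}) v : v *m orthoproj U \in U.
Proof.
by rewrite mem_basis_mx mulmxA submxMl.
Qed.

Lemma orthoproj_id m (U : {vspace 'rV[R]_m}) v :
  v \in U -> v *m orthoproj U = v.
Proof.
rewrite mem_basis_mx => /submxP[D ->].
by rewrite /orthoproj /gram_proj !mulmxA -(mulmxA D) mulmxK// gram_unitmx basis_mx_free.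
Qed.

(** With [Q] the projection, the hypotheses give [P *m Q = P] and [Q *m P = Q]; transposing the
    first, by symmetry of both, gives [P = Q]. *)
Lemma orthoproj_eq m (U : {vspace 'rV[R]_m}) P :
    P^T = P -> (forall v, v *m P \in U) -> {in U, forall v, v *m P = v} ->
  orthoproj U = P.
Proof.
move=> trP memP idP; set Q := orthoproj U.
have PQ : P *m Q = P.
  by apply/row_matrixP => i; rewrite row_mul orthoproj_id// rowE memP.
have QP : Q *m P = Q.
  by apply/row_matrixP => i; rewrite row_mul idP// rowE orthoproj_mem.
by rewrite -[RHS]trP -[in RHS]PQ trmx_mul trP tr_orthoproj QP.
Qed.

Lemma row_span_orthoproj m (U : {vspace 'rV[R]_m}) : row_span (orthoproj U) = U.
Proof.
apply/eqP; rewrite eqEsubv; apply/andP; split.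
  by apply/row_span_leP => v; exact: orthoproj_mem.
by apply/subvP => v /orthoproj_id <-; rewrite mem_row_span submxMl.
Qed.

Lemma orthoproj_row_span k m (B : 'M[R]_(k, m)) :
  row_free B -> orthoproj (row_span B) = gram_proj B.
Proof.
move=> freeB; apply: orthoproj_eq.
- by rewrite /gram_proj !trmx_mul trmxK trmx_inv trmx_mul trmxK mulmxA.
- by move=> v; rewrite mem_row_span mulmxA submxMl.
- move=> v; rewrite mem_row_span => /submxP[D ->].
  by rewrite /gram_proj !mulmxA -(mulmxA D) mulmxK// gram_unitmx.
Qed.

Lemma row_span_col_mx k l m (A : 'M[R]_(k, m)) (B : 'M[R]_(l, m)) :
  row_span (col_mx A B) = (row_span A + row_span B)%VS.
Proof.
apply/eqP; rewrite eqEsubv subv_add; apply/and3P; split.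
- apply/row_span_leP => v; rewrite -[v]hsubmxK mul_row_col memv_add//;
  by rewrite mem_row_span submxMl.
- apply/row_span_leP => v; rewrite mem_row_span.
  by rewrite (submx_trans (submxMl _ _))// -addsmxE addsmxSl.
- apply/row_span_leP => v; rewrite mem_row_span.
  by rewrite (submx_trans (submxMl _ _))// -addsmxE addsmxSr.
Qed.

(** The rows of [1%:M - orthoproj U] span the orthogonal complement of [U], and an intersection is
    the complement of the sum of the complements. Intersections are thereby reduced to row spans. *)
Lemma orthoproj_cap m (U V : {vspace 'rV[R]_m}) :
  orthoproj (U :&: V) =
  1%:M - orthoproj (row_span (col_mx (1%:M - orthoproj U) (1%:M - orthoproj V))).
Proof.
set W := row_span _.
have orthW v w : v \in (U :&: V)%VS -> w \in W -> v *m w^T = 0.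
  rewrite memv_cap => /andP[vU vV]; rewrite mem_row_span => /submxP[D ->].
  rewrite trmx_mul tr_col_mx !linearB /= !tr_orthoproj trmx1 mulmxA.
  by rewrite mul_mx_row !mulmxBr mulmx1 !orthoproj_id// subrr row_mx0 mul0mx.
apply: orthoproj_eq.
- by rewrite linearB /= trmx1 tr_orthoproj.
- move=> v; set w := v *m _.
  have ww u : u \in W -> w *m u^T = 0.
    move=> uW; rewrite -(orthoproj_id uW) trmx_mul tr_orthoproj mulmxA.
    rewrite /w mulmxBr mulmx1 mulmxBl.
    by rewrite [X in _ - X]orthoproj_id ?orthoproj_mem// subrr mul0mx.
  have wker A : (row_span A <= W)%VS -> w *m A^T = 0.
    move=> sAW; apply/trmx_inj; rewrite trmx_mul trmxK trmx0.
    apply/row_matrixP => i; rewrite row_mul row0; apply/trmx_inj.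
    rewrite trmx_mul trmxK trmx0 ww//; apply: (subvP sAW).
    by rewrite mem_row_span row_sub.
  (* A vector orthogonal to the complement of [U'] is fixed by the projection onto [U'], so it lies
     in [U']. *)
  have wmem U' : (row_span (1%:M - orthoproj U') <= W)%VS -> w \in U'.
    move/wker; rewrite linearB /= trmx1 tr_orthoproj mulmxBr mulmx1.
    by move/subr0_eq=> ->; exact: orthoproj_mem.
  by rewrite memv_cap !wmem // /W row_span_col_mx ?addvSl ?addvSr.
- move=> v vUV; rewrite mulmxBr mulmx1.
  suff -> : v *m orthoproj W = 0 by rewrite subr0.
  apply/rowP => j.
  have /rowP/(_ 0) := orthW v (delta_mx 0 j *m orthoproj W) vUV (orthoproj_mem _ _).
  by rewrite trmx_mul tr_orthoproj mulmxA trmx_delta -colE mxE [RHS]mxE => ->; rewrite mxE.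
Qed.
End OrthogonalProjection.

(** * Continuity of the orthogonal projection *)

Section MatrixLimits.
Variables (R : realType) (T : Type) (F : set_system T).
Context {FF : Filter F}.

Lemma cvg_mx m n (f : T -> 'M[R]_(m, n)) (A : 'M[R]_(m, n)) :
  (forall i j, f x i j @[x --> F] --> A i j) -> f x @[x --> F] --> A.
Proof.
move=> fA B [P nP sPB].
suff : \forall x \near F, forall i j, P i j (f x i j).
  by apply: filterS => x Px; exact: sPB.
by apply: filter_forall => i; apply: filter_forall => j; exact: fA.
Qed.

Lemma cvg_coord m n (f : T -> 'M[R]_(m, n)) (A : 'M[R]_(m, n)) i j :
  f x @[x --> F] --> A -> f x i j @[x --> F] --> A i j.
Proof. exact: (continuous_cvg _ (@coord_continuous R m n i j A)). Qed.

Lemma cvg_det n (f : T -> 'M[R]_n) (A : 'M[R]_n) :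
  f x @[x --> F] --> A -> \det (f x) @[x --> F] --> \det A.
Proof.
move=> fA; apply: cvg_big => [|s _]; first exact: add_continuous.
apply: cvgM; first exact: cvg_cst.
apply: cvg_big => [|i _]; last exact: cvg_coord.
by move=> x; apply: cvgM; [exact: cvg_fst | exact: cvg_snd].
Qed.

Lemma cvg_trmx m n (f : T -> 'M[R]_(m, n)) (A : 'M[R]_(m, n)) :
  f x @[x --> F] --> A -> (f x)^T @[x --> F] --> A^T.
Proof.
move=> fA; apply: cvg_mx => i j; under eq_cvg do rewrite mxE.
by rewrite mxE; exact: cvg_coord.
Qed.

Lemma cvg_mulmx m n p (f : T -> 'M[R]_(m, n)) (g : T -> 'M[R]_(n, p))
    (A : 'M[R]_(m, n)) (B : 'M[R]_(n, p)) :
  f x @[x --> F] --> A -> g x @[x --> F] --> B ->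
  f x *m g x @[x --> F] --> A *m B.
Proof.
move=> fA gB; apply: cvg_mx => i j; under eq_cvg do rewrite mxE.
rewrite mxE; apply: cvg_big => [|k _]; first exact: add_continuous.
by apply: cvgM; exact: cvg_coord.
Qed.

Lemma cvg_col_mx m1 m2 n (f : T -> 'M[R]_(m1, n)) (g : T -> 'M[R]_(m2, n))
    (A : 'M[R]_(m1, n)) (B : 'M[R]_(m2, n)) :
  f x @[x --> F] --> A -> g x @[x --> F] --> B ->
  col_mx (f x) (g x) @[x --> F] --> col_mx A B.
Proof.
move=> fA gB; apply: cvg_mx => i j; under eq_cvg do rewrite mxE.
by rewrite mxE; case: (fintype.split i) => k; exact: cvg_coord.
Qed.

Lemma cvg_addmx m n (f g : T -> 'M[R]_(m, n)) (A B : 'M[R]_(m, n)) :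
  f x @[x --> F] --> A -> g x @[x --> F] --> B ->
  f x + g x @[x --> F] --> A + B.
Proof.
move=> fA gB; apply: cvg_mx => i j; under eq_cvg do rewrite mxE.
by rewrite mxE; apply: cvgD; exact: cvg_coord.
Qed.

Lemma cvg_scalemx m n (s : T -> R) (f : T -> 'M[R]_(m, n)) (a : R) (A : 'M[R]_(m, n)) :
  s x @[x --> F] --> a -> f x @[x --> F] --> A ->
  s x *: f x @[x --> F] --> a *: A.
Proof.
move=> sa fA; apply: cvg_mx => i j; under eq_cvg do rewrite mxE.
by rewrite mxE; apply: cvgM => //; exact: cvg_coord.
Qed.

Lemma cvg_oppmx m n (f : T -> 'M[R]_(m, n)) (A : 'M[R]_(m, n)) :
  f x @[x --> F] --> A -> - f x @[x --> F] --> - A.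
Proof.
move=> fA; apply: cvg_mx => i j; under eq_cvg do rewrite mxE.
by rewrite mxE; apply: cvgN; exact: cvg_coord.
Qed.

Lemma cvg_adjugate n (f : T -> 'M[R]_n) (A : 'M[R]_n) :
  f x @[x --> F] --> A -> \adj (f x) @[x --> F] --> \adj A.
Proof.
move=> fA; apply: cvg_mx => i j; under eq_cvg do rewrite mxE.
rewrite mxE /cofactor; apply: cvgM; first exact: cvg_cst.
apply: cvg_det; apply: cvg_mx => k l; under eq_cvg do rewrite !mxE.
by rewrite !mxE; exact: cvg_coord.
Qed.

Lemma near_unitmx n (f : T -> 'M[R]_n) (A : 'M[R]_n) :
  f x @[x --> F] --> A -> A \in unitmx -> \forall x \near F, f x \in unitmx.
Proof.
rewrite unitmxE unitfE => fA.
move/(cvgr_neq0 _ (cvg_det fA)); apply: filterS => x.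
by rewrite unitmxE unitfE.
Qed.

Lemma cvg_invmx n (f : T -> 'M[R]_n) (A : 'M[R]_n) :
  f x @[x --> F] --> A -> A \in unitmx -> invmx (f x) @[x --> F] --> invmx A.
Proof.
move=> fA Au.
(* [invmx] is defined by cases; near the limit the matrices are invertible, so the adjugate formula
   applies there. *)
have eqf : {near F, (fun x => (\det (f x))^-1 *: \adj (f x)) =1
                    (fun x => invmx (f x))}.
  by have := near_unitmx fA Au; apply: filterS => x; rewrite /invmx => ->.
apply: cvg_trans (near_eq_cvg eqf) _.
rewrite /invmx Au; apply: cvg_scalemx; last exact: cvg_adjugate.
apply: cvgV; last exact: cvg_det.
by rewrite -unitfE -unitmxE.
Qed.

Lemma near_row_free k m (f : T -> 'M[R]_(k, m)) (B : 'M[R]_(k, m)) :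
  f x @[x --> F] --> B -> row_free B -> \forall x \near F, row_free (f x).
Proof.
move=> fB; rewrite -gram_unitmx => /(near_unitmx (cvg_mulmx fB (cvg_trmx fB))).
by apply: filterS => x; rewrite gram_unitmx.
Qed.

Lemma cvg_gram_proj k m (f : T -> 'M[R]_(k, m)) (B : 'M[R]_(k, m)) :
  f x @[x --> F] --> B -> row_free B ->
  gram_proj (f x) @[x --> F] --> gram_proj B.
Proof.
move=> fB freeB; have fBT := cvg_trmx fB.
apply: cvg_mulmx => //; apply: cvg_mulmx => //; apply: cvg_invmx.
  exact: cvg_mulmx.
by rewrite gram_unitmx.
Qed.

(** Constant rank excludes the dimension jumps at which the projection is discontinuous. The rows
    may be dependent, so stacked projection matrices are covered. *)
Lemma cvg_orthoproj_row_span p m (f : T -> 'M[R]_(p, m)) (A : 'M[R]_(p, m)) :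
    f x @[x --> F] --> A -> (forall x, \rank (f x) = \rank A) ->
  orthoproj (row_span (f x)) @[x --> F] --> orthoproj (row_span A).
Proof.
move=> fA rkf.
have /submxP[S defB] : (row_base A <= A)%MS by rewrite eq_row_base.
(* The rows of [S *m f x] remain independent near the limit, hence still span
   the row space of [f x], whose dimension is constant. *)
have SfB : S *m f x @[x --> F] --> row_base A.
  by rewrite defB; apply: cvg_mulmx => //; exact: cvg_cst.
have -> : row_span A = row_span (row_base A).
  by apply/vspaceP => v; rewrite !mem_row_span eq_row_base.
have eqf : {near F, (fun x => gram_proj (S *m f x)) =1
                    (fun x => orthoproj (row_span (f x)))}.
  have := near_row_free SfB (row_base_free A); apply: filterS => x freeSf.
  rewrite -orthoproj_row_span//; congr (orthoproj _).
  apply/eqP; rewrite eqEdim !dim_row_span_rank rkf (eqP freeSf) leqnn andbT.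
  by apply/row_span_leP => v; rewrite mem_row_span mulmxA submxMl.
apply: cvg_trans (near_eq_cvg eqf) _.
by rewrite orthoproj_row_span ?row_base_free//; exact: cvg_gram_proj (row_base_free _).
Qed.
End MatrixLimits.

(** * The Grassmannian topology through projection matrices *)

Lemma row_span_surj (R : realType) k m (U : {vspace 'rV[R]_m}) :
  \dim U = k -> exists2 B : 'M[R]_(k, m), row_free B & row_span B = U.
Proof.
by move=> <-; exists (basis_mx U); rewrite ?basis_mx_free ?row_span_basis_mx.
Qed.

Lemma continuous_val (X : topologicalType) (A : set X) :
  continuous (val : A -> X).
Proof. exact: (@initial_continuous A X set_val). Qed.

Lemma continuous_to_set_type (X Y : topologicalType) (A : set X) (f : Y -> A) :
  continuous (fun y => val (f y)) -> continuous f.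
Proof. exact: (@continuous_comp_initial A Y X set_val f). Qed.

(** In the quotient topology openness is tested on frames, where the row span has constant rank
    [k]. *)
Lemma continuous_orthoproj (R : realType) k m :
  continuous (fun U : grassmannian R k m => orthoproj (val U)).
Proof.
apply/continuousP => A oA.
change (open ((fun M : frame R k m => orthoproj (row_span (val M))) @^-1` A)).
move: A oA; apply/continuousP => M.
apply: (@cvg_orthoproj_row_span _ _ _ (nbhs_filter M)); first exact: continuous_val.
by move=> N; rewrite -!dim_row_span_rank !(eqP (dim_row_span _)).
Qed.

(** Together with [continuous_orthoproj] this makes the topology initial for the projection matrix,
    so that later continuity proofs only handle matrices. *)
Lemma continuous_to_grassmannian (R : realType) (X : topologicalType) k m
    (phi : X -> grassmannian R k m) :
  continuous (fun x => orthoproj (val (phi x))) -> continuous phi.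
Proof.
move=> cphi x0 A; rewrite nbhsE ; case=> O [oO Ox0] sOA.
have dimB x : \dim (val (phi x)) = k by apply/eqP/(valP (phi x)).
have [B freeB spanB] : exists2 B : 'M[R]_(k, m), row_free B & row_span B = val (phi x0).
  exact: row_span_surj (dimB x0).
have BB : B *m orthoproj (val (phi x0)) = B.
  apply/row_matrixP => i; rewrite row_mul orthoproj_id// -spanB mem_row_span.
  exact: row_sub.
(* Projecting a frame [B] of [phi x0] onto [phi x] gives, for [x] near [x0], a
   frame of [phi x] that is close to [B]. *)
have cB : B *m orthoproj (val (phi x)) @[x --> x0] --> B.
  by rewrite -[X in _ --> X]BB; apply: cvg_mulmx; [exact: cvg_cst | exact: cphi].
have frame_phi x (free : row_free (B *m orthoproj (val (phi x)))) :
    frame_span (frame_of free) = phi x.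
  apply/val_inj/eqP; rewrite /= eqEdim dim_row_span_rank (eqP free) dimB leqnn andbT.
  by apply/row_span_leP => v; rewrite mulmxA orthoproj_mem.
(* By the quotient and subspace topologies, the frames spanning a member of [O] are exactly the
   frames in some open set [W] of matrices. *)
have [W oW defW] : open (@frame_span R k m @^-1` O) := oO.
have WB : W B.
  have free0 : row_free (B *m orthoproj (val (phi x0))) by rewrite BB.
  have : (@frame_span R k m @^-1` O) (frame_of free0) by rewrite /= frame_phi.
  by rewrite -defW -[X in _ -> W X]BB; apply: id.
have nW : \forall x \near x0, W (B *m orthoproj (val (phi x))).
  by apply: cB; exact: open_nbhs_nbhs.
have nfree : \forall x \near x0, row_free (B *m orthoproj (val (phi x))).
  exact: near_row_free cB freeB.
suff : \forall x \near x0, A (phi x) by [].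
apply: filterS2 nW nfree => x Wx freex; apply: sOA.
rewrite -(frame_phi _ freex).
suff : (@frame_span R k m @^-1` O) (frame_of freex) by [].
by rewrite -defW; exact: Wx.
Qed.

(** * Continuous families of subspaces *)

Section ContinuousSubspaces.
Variables (R : realType) (X : topologicalType) (m : nat).
Implicit Types U V : X -> {vspace 'rV[R]_m}.

(** Cyclicity of the trace turns [gram_proj B] into the identity matrix of size [\dim U]. *)
Lemma mxtrace_orthoproj (U : {vspace 'rV[R]_m}) :
  \tr (orthoproj U) = (\dim U)%:R.
Proof.
rewrite /orthoproj /gram_proj -mulmxA mxtrace_mulC -mulmxA mulVmx ?mxtrace1//.
by rewrite gram_unitmx basis_mx_free.
Qed.

(** Continuity is stated for bare subspaces, without a dimension in the type, so that sums,
    intersections and images can be formed freely. *)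
Definition vcontinuous U := continuous (fun x => orthoproj (U x)).

Lemma vcontinuous_row_span p k (A : X -> 'M[R]_(p, m)) :
    continuous A -> (forall x, \dim (row_span (A x)) = k) ->
  vcontinuous (fun x => row_span (A x)).
Proof.
move=> cA dimA x; apply: cvg_orthoproj_row_span; first exact: cA.
by move=> y; rewrite -!dim_row_span_rank !dimA.
Qed.

(** The sum is the row span of the two stacked projections, whose rank is constant by assumption. *)
Lemma vcontinuous_add U V k :
    vcontinuous U -> vcontinuous V -> (forall x, \dim (U x + V x) = k) ->
  vcontinuous (fun x => U x + V x)%VS.
Proof.
move=> cU cV dimUV.
have addE x : (U x + V x)%VS = row_span (col_mx (orthoproj (U x)) (orthoproj (V x))).
  by rewrite row_span_col_mx !row_span_orthoproj.
rewrite (_ : (fun x => _) = fun x => row_span (col_mx (orthoproj (U x)) (orthoproj (V x)))); last first.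
  exact/funext/addE.
apply: (@vcontinuous_row_span _ k) => x; last by rewrite -addE.
by apply: cvg_col_mx; [exact: cU | exact: cV].
Qed.

Lemma vcontinuous_cap U V k :
    vcontinuous U -> vcontinuous V -> (forall x, \dim (U x :&: V x) = k) ->
  vcontinuous (fun x => U x :&: V x)%VS.
Proof.
move=> cU cV dimUV.
(* [W x] is the orthogonal complement of the intersection, hence of constant dimension [m - k]. *)
pose W x := row_span (col_mx (1%:M - orthoproj (U x)) (1%:M - orthoproj (V x))).
have capE x : orthoproj (U x :&: V x) = 1%:M - orthoproj (W x) by exact: orthoproj_cap.
(* The trace of an orthogonal projection is the dimension of its image. *)
have dimW x : \dim (W x) = (m - k)%N.
  have /(congr1 (@mxtrace _ _)) := capE x.
  rewrite linearB /= mxtrace1 !mxtrace_orthoproj dimUV => /eqP.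
  by rewrite eq_sym subr_eq -natrD eqr_nat => /eqP; lia.
rewrite /vcontinuous (_ : (fun x => _) = fun x => 1%:M - orthoproj (W x)); last first.
  exact/funext/capE.
move=> x; apply: cvg_addmx; first exact: cvg_cst.
apply: cvg_oppmx; apply: vcontinuous_row_span dimW _ => y.
by apply: cvg_col_mx; apply: cvg_addmx; [exact: cvg_cst | apply: cvg_oppmx; exact: cU
  | exact: cvg_cst | apply: cvg_oppmx; exact: cV].
Qed.
End ContinuousSubspaces.

(** * Interpolation between the identity and orthogonal projection *)

Section Shear.
Variables (R : realType) (m : nat).
Implicit Types (U V W : {vspace 'rV[R]_m}) (s : R).

(** The identity at [s = 0] and the orthogonal projection onto the complement of [U] at [s = 1]. *)
Definition shear_fun s U : 'End('rV[R]_m) :=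
  linfun (mulmxr (1%:M - s *: orthoproj U)).

Definition shear s U W := (shear_fun s U @: W)%VS.

(** Presents the image as the row span of a matrix continuous in [s] and in both projections. *)
Lemma shear_row_span s U W :
  shear s U W = row_span (orthoproj W *m (1%:M - s *: orthoproj U)).
Proof.
apply/vspaceP => v; rewrite mem_row_span; apply/memv_imgP/submxP => [[u uW ->]|[D ->]].
  by exists u; rewrite lfunE /= mulmxA orthoproj_id.
by exists (D *m orthoproj W); rewrite ?orthoproj_mem// lfunE /= mulmxA.
Qed.

Lemma shear_funE s U v : shear_fun s U v = v - s *: (v *m orthoproj U).
Proof. by rewrite lfunE /= mulmxBr mulmx1 -scalemxAr. Qed.

Lemma shearD s U V W : shear s U (V + W) = (shear s U V + shear s U W)%VS.
Proof. exact: limgD. Qed.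

Lemma shear0 U W : shear 0 U W = W.
Proof.
rewrite shear_row_span scale0r subr0 mulmx1; exact: row_span_orthoproj.
Qed.

Lemma shear1_sub U W : (W <= U)%VS -> shear 1 U W = 0%VS.
Proof.
move=> sWU; rewrite shear_row_span; apply/eqP; rewrite -subv0.
apply/row_span_leP => v; rewrite memv0 mulmxA mulmxBr mulmx1 scale1r.
by rewrite [X in _ - X]orthoproj_id ?subrr//; apply: (subvP sWU); exact: orthoproj_mem.
Qed.

(** A vector killed by the shear equals [s] times its projection to [U], so it lies in [U]; the
    shear is thus injective on [W]. *)
Lemma dim_shear s U W : (U :&: W = 0)%VS -> \dim (shear s U W) = \dim W.
Proof.
move=> UW0; apply: limg_dim_eq; apply/eqP; rewrite -subv0 -UW0.
apply/subvP => v; rewrite !memv_cap => /andP[vW]; rewrite vW andbT.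
rewrite memv_ker shear_funE subr_eq0 => /eqP ->.
by rewrite memvZ// orthoproj_mem.
Qed.

(** The shear moves every vector by an element of [U] only. *)
Lemma addv_shear s U W : (U + shear s U W = U + W)%VS.
Proof.
apply/eqP; rewrite eqEsubv !subv_add !addvSl /=; apply/andP; split.
  apply/subvP => _ /memv_imgP[v vW ->]; rewrite shear_funE addrC memv_add//.
  by rewrite memvN memvZ// orthoproj_mem.
apply/subvP => v vW; rewrite -[v](subrK (s *: (v *m orthoproj U))) addrC.
rewrite memv_add ?memvZ ?orthoproj_mem// -shear_funE; exact: memv_img.
Qed.
End Shear.

Lemma vcontinuous_shear (R : realType) (X : topologicalType) m k
    (s : X -> R) (U W : X -> {vspace 'rV[R]_m}) :
    continuous s -> vcontinuous U -> vcontinuous W ->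
    (forall x, \dim (shear (s x) (U x) (W x)) = k) ->
  vcontinuous (fun x => shear (s x) (U x) (W x)).
Proof.
move=> cs cU cW dimS.
pose M x := orthoproj (W x) *m (1%:M - s x *: orthoproj (U x)).
rewrite (_ : (fun x => _) = fun x => row_span (M x)); last first.
  by apply/funext => x; exact: shear_row_span.
apply: (@vcontinuous_row_span _ _ _ _ k) => x; last by rewrite -shear_row_span.
apply: cvg_mulmx; first exact: cW.
apply: cvg_addmx; first exact: cvg_cst.
by apply: cvg_oppmx; apply: cvg_scalemx; [exact: cs | exact: cU].
Qed.

(** * Triples of lines and flags *)

Section IndependentLines.
Variables (R : realType) (m : nat).
Implicit Types (U V W L : {vspace 'rV[R]_m}).

Definition independent_lines L1 L2 L3 :=
  [/\ \dim L1 = 1%N, \dim L2 = 1%N, \dim L3 = 1%N & \dim (L1 + L2 + L3) = 3%N].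

Lemma independent_lines_swap12 L1 L2 L3 :
  independent_lines L1 L2 L3 -> independent_lines L2 L1 L3.
Proof. by case=> ? ? ?; rewrite (addvC L1) => ?; split. Qed.

Lemma independent_lines_swap23 L1 L2 L3 :
  independent_lines L1 L2 L3 -> independent_lines L1 L3 L2.
Proof. by case=> ? ? ?; rewrite -addvA (addvC L2) addvA => ?; split. Qed.

Lemma independent_lines_dim2 L1 L2 L3 :
  independent_lines L1 L2 L3 -> \dim (L1 + L2) = 2%N.
Proof.
by case=> d1 d2 d3 d; have := dimv_sum_cap L1 L2; have := dimv_sum_cap (L1 + L2) L3; lia.
Qed.

(** Two planes inside a space of dimension 3 that they span meet in dimension 2 + 2 - 3 = 1, and
    [L1] lies in both. *)
Lemma independent_lines_cap L1 L2 L3 :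
  independent_lines L1 L2 L3 -> ((L1 + L2) :&: (L1 + L3) = L1)%VS.
Proof.
move=> ind; have d12 := independent_lines_dim2 ind.
have d13 := independent_lines_dim2 (independent_lines_swap23 ind).
case: ind => d1 _ _ d; apply/esym/eqP; rewrite eqEdim subv_cap !addvSl d1 /=.
have := dimv_sum_cap (L1 + L2) (L1 + L3).
rewrite (_ : (L1 + L2 + (L1 + L3) = L1 + L2 + L3)%VS); first lia.
by rewrite addvA (addvC (L1 + L2)%VS L1) addvA addvv.
Qed.

Lemma independent_lines_cap0 L1 L2 L3 :
  independent_lines L1 L2 L3 -> (L1 :&: L2 = 0)%VS /\ ((L1 + L2) :&: L3 = 0)%VS.
Proof.
move=> ind; have d12 := independent_lines_dim2 ind; case: ind => d1 d2 d3 d.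
split; apply/eqP; rewrite -dimv_eq0.
  by have := dimv_sum_cap L1 L2; lia.
by have := dimv_sum_cap (L1 + L2) L3; lia.
Qed.

Lemma independent_lines_shear s r L1 L2 L3 :
  independent_lines L1 L2 L3 ->
  independent_lines L1 (shear s L1 L2) (shear r (L1 + L2) L3).
Proof.
move=> ind; have [c12 c3] := independent_lines_cap0 ind.
case: ind => d1 d2 d3 d; split => //; rewrite ?dim_shear//.
by rewrite addv_shear addv_shear.
Qed.

(** For [U] inside [V], [shear 1 U V] is the orthogonal complement of [U] in [V]. It is unchanged
    when [V] is replaced by a linear complement [V :\: U], since [U] is killed; this reduces the
    claim to shearing independent lines. *)
Lemma flag_independent_lines V1 V2 V3 :
    \dim V1 = 1%N -> \dim V2 = 2%N -> \dim V3 = 3%N ->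
    (V1 <= V2)%VS -> (V2 <= V3)%VS ->
  independent_lines V1 (shear 1 V1 V2) (shear 1 V2 V3).
Proof.
move=> d1 d2 d3 s12 s23.
have splitv U V : (U <= V)%VS -> (V = U + (V :\: U))%VS.
  by move=> /capv_idPr UV; rewrite -[LHS](addv_diff_cap V U) UV addvC.
have shear_diff U V : (U <= V)%VS -> shear 1 U V = shear 1 U (V :\: U).
  by move=> sUV; rewrite [in LHS](splitv _ _ sUV) shearD shear1_sub// add0v.
have dim_diff U V : (U <= V)%VS -> \dim (V :\: U) = (\dim V - \dim U)%N.
  by move=> /capv_idPr UV; have := dimv_cap_compl V U; rewrite UV; lia.
rewrite (shear_diff _ _ s12) (shear_diff _ _ s23).
(* Writes [V2] as the sum of the first two lines, the form in which [independent_lines_shear]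
   applies. *)
rewrite [X in shear 1 X (V3 :\: V2)](splitv _ _ s12).
apply: independent_lines_shear; split; rewrite ?dim_diff// ?d1 ?d2 ?d3//.
by rewrite -(splitv _ _ s12) -(splitv _ _ s23).
Qed.

Lemma dim_add_lines L L' :
  \dim L = 1%N -> \dim L' = 1%N -> L <> L' -> \dim (L + L') = 2%N.
Proof.
move=> d d' neqL; have := dimv_sum_cap L L'.
suff : \dim (L :&: L') != 1%N by have := dimvS (capvSl L L'); lia.
apply/eqP => dc; apply: neqL.
have /eqP <- : (L :&: L' == L)%VS by rewrite eqEdim capvSl d dc.
by apply/eqP; rewrite eqEdim capvSr d' dc.
Qed.
End IndependentLines.

(** * Continuity for subspaces of products of Grassmannians *)

Lemma continuous_pair (X Y Z : topologicalType) (f : X -> Y) (g : X -> Z) :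
  continuous f -> continuous g -> continuous (fun x => (f x, g x)).
Proof.
move=> cf cg x; apply: (@cvg_pair _ _ _ _ (nbhs (f x)) (nbhs (g x))).
  exact: cf.
exact: cg.
Qed.

Lemma continuous_fst (X Y : topologicalType) : continuous (@fst X Y).
Proof. by move=> x; exact: cvg_fst. Qed.

Lemma continuous_snd (X Y : topologicalType) : continuous (@snd X Y).
Proof. by move=> x; exact: cvg_snd. Qed.

Lemma continuous_compT (X Y Z : topologicalType) (f : X -> Y) (g : Y -> Z) :
  continuous f -> continuous g -> continuous (fun x => g (f x)).
Proof. by move=> cf cg x; exact: (continuous_comp (cf x) (cg (f x))). Qed.

Section GrassmannianProducts.
Variables (R : realType) (m k1 k2 k3 : nat).

Definition grassmannian_of k (U : {vspace 'rV[R]_m}) (dimU : \dim U = k) :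
  grassmannian R k m := exist _ U (introT eqP dimU).

Lemma dim_grassmannian k (U : grassmannian R k m) : \dim (val U) = k.
Proof. exact/eqP/(valP U). Qed.

Variable A : set (grassmannian R k1 m * grassmannian R k2 m * grassmannian R k3 m).

Lemma continuous_to_grassmannians (X : topologicalType) (f : X -> A) :
    vcontinuous (fun x => val (val (f x)).1.1) ->
    vcontinuous (fun x => val (val (f x)).1.2) ->
    vcontinuous (fun x => val (val (f x)).2) ->
  continuous f.
Proof.
move=> /continuous_to_grassmannian c1 /continuous_to_grassmannian c2.
move=> /continuous_to_grassmannian c3; apply: continuous_to_set_type.
have -> : (fun x => val (f x)) =
    fun x => ((val (f x)).1.1, (val (f x)).1.2, (val (f x)).2).
  by apply/funext => x; case: (val (f x)) => -[].
apply: continuous_pair c3; exact: continuous_pair c1 c2.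
Qed.

Lemma vcontinuous_comp (X Y : topologicalType) (f : X -> Y)
    (U : Y -> {vspace 'rV[R]_m}) :
  continuous f -> vcontinuous U -> vcontinuous (fun x => U (f x)).
Proof.
exact: continuous_compT.
Qed.

Lemma vcontinuous_grassmannians :
  [/\ vcontinuous (fun x : A => val (val x).1.1),
      vcontinuous (fun x : A => val (val x).1.2)
    & vcontinuous (fun x : A => val (val x).2)].
Proof.
have cv : continuous (val : A -> _) := @continuous_val _ A.
have c1 : continuous (fun x : A => (val x).1) := continuous_compT cv (@continuous_fst _ _).
split; apply: vcontinuous_comp (@continuous_orthoproj _ _ _).
- exact: continuous_compT c1 (@continuous_fst _ _).
- exact: continuous_compT c1 (@continuous_snd _ _).
- exact: continuous_compT cv (@continuous_snd _ _).
Qed.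

(** Equality of triples or flags reduces to equality of three subspaces, the attached proofs being
    irrelevant. *)
Lemma grassmannians_inj (x y : A) :
    val (val x).1.1 = val (val y).1.1 -> val (val x).1.2 = val (val y).1.2 ->
    val (val x).2 = val (val y).2 ->
  x = y.
Proof.
move=> /val_inj e1 /val_inj e2 /val_inj e3; apply: val_inj.
by move: e1 e2 e3; case: (val x) => -[? ?] ?; case: (val y) => -[? ?] ? /= -> -> ->.
Qed.
End GrassmannianProducts.

(** * Triangles of lines, their vertices and their flags *)

Section LineTriples.
Variables (R : realType) (n : nat).
Local Notation vsp := {vspace 'rV[R]_n.+1}.
Implicit Types (L : vsp) (l a b : proj_line R n) (T : line_triples R n)
  (V : flag123 R n.+1).

Lemma dim_meet_properly l a : meet_properly l a -> \dim (val l :&: val a) = 1%N.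
Proof.
case=> neq_la /eqP; rewrite -dimv_eq0 => cap0.
have [dl da] := (dim_grassmannian l, dim_grassmannian a).
suff : \dim (val l :&: val a) != 2%N.
  by have := dimvS (capvSl (val l) (val a)); lia.
apply/eqP => dc; apply: neq_la; apply: val_inj.
have /eqP <- : (val l :&: val a == val l)%VS by rewrite eqEdim capvSl dl dc.
by apply/eqP; rewrite eqEdim capvSr da dc.
Qed.

(** The line [l] meets [a] in [L1] and [b] in [L2], and these differ because [L1 + L2] has dimension
    2. *)
Lemma independent_lines_meet L1 L2 L3 l a b :
    independent_lines L1 L2 L3 ->
    val l = (L1 + L2)%VS -> val a = (L1 + L3)%VS -> val b = (L2 + L3)%VS ->
  meets_at_distinct_points l a b.
Proof.
move=> ind el ea eb.
have ela : (val l :&: val a = L1)%VS.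
  by rewrite el ea; exact: independent_lines_cap ind.
have elb : (val l :&: val b = L2)%VS.
  rewrite el eb addvC; apply: independent_lines_cap.
  exact: independent_lines_swap12 ind.
have dl := dim_grassmannian l; have d12 := independent_lines_dim2 ind.
case: ind => d1 d2 _ _.
have proper c L : \dim L = 1%N -> (val l :&: val c = L)%VS -> meet_properly l c.
  move=> dL elc; split=> [elc'|]; last by rewrite elc => L0; rewrite L0 dimv0 in dL.
  by move: elc; rewrite -elc' capvv => elL; rewrite -elL dl in dL.
split; [exact: proper ela | exact: proper elb |].
by rewrite ela elb => e12; move: d12; rewrite e12 addvv d2.
Qed.

Section TripleOfIndependentLines.
Variables L1 L2 L3 : vsp.
Hypothesis ind : independent_lines L1 L2 L3.
Let ind132 := independent_lines_swap23 ind.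
Let ind231 := independent_lines_swap23 (independent_lines_swap12 ind).

Let l1 : proj_line R n := grassmannian_of (independent_lines_dim2 ind).
Let l2 : proj_line R n := grassmannian_of (independent_lines_dim2 ind132).
Let l3 : proj_line R n := grassmannian_of (independent_lines_dim2 ind231).

Lemma triangle_subproof :
  [/\ meets_at_distinct_points l1 l2 l3, meets_at_distinct_points l2 l1 l3
    & meets_at_distinct_points l3 l1 l2].
Proof.
split.
- exact: independent_lines_meet ind _ _ _.
- by apply: independent_lines_meet ind132 _ _ _ => //; rewrite addvC.
- by apply: independent_lines_meet ind231 _ _ _ => //; rewrite addvC.
Qed.

(** The sides are ordered so that [L1], [L2], [L3] become [vertex12], [vertex13], [vertex23]
    respectively. *)
Definition triangle : line_triples R n := exist _ (l1, l2, l3) (mem_set triangle_subproof).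
End TripleOfIndependentLines.

Definition side1 T : vsp := val (val T).1.1.
Definition side2 T : vsp := val (val T).1.2.
Definition side3 T : vsp := val (val T).2.
Definition vertex12 T := (side1 T :&: side2 T)%VS.
Definition vertex13 T := (side1 T :&: side3 T)%VS.
Definition vertex23 T := (side2 T :&: side3 T)%VS.

(** Each side contains two distinct vertices and is therefore their sum; the three vertices are
    independent because [vertex23] is not on [side1]. *)
Lemma triangle_vertices T :
  [/\ independent_lines (vertex12 T) (vertex13 T) (vertex23 T),
      side1 T = (vertex12 T + vertex13 T)%VS,
      side2 T = (vertex12 T + vertex23 T)%VS
    & side3 T = (vertex13 T + vertex23 T)%VS].
Proof.
have [[m12 m13 n1] [m21 m23 n2] [m31 m32 n3]] := set_mem (valP T).
have d12 := dim_meet_properly m12.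
have d13 := dim_meet_properly m13.
have d23 := dim_meet_properly m23.
rewrite -/(side1 T) -/(side2 T) -/(side3 T) in n1 n2 n3 d12 d13 d23.
rewrite -/(vertex12 T) -/(vertex13 T) -/(vertex23 T) in n1 d12 d13 d23.
rewrite (capvC (side2 T)) -/(vertex12 T) -/(vertex23 T) in n2.
rewrite (capvC _ (side1 T)) (capvC _ (side2 T)) -/(vertex13 T) -/(vertex23 T) in n3.
have sideE (S L L' : vsp) : \dim S = 2%N -> \dim L = 1%N -> \dim L' = 1%N ->
    L <> L' -> (L <= S)%VS -> (L' <= S)%VS -> S = (L + L')%VS.
  move=> dS dL dL' neqL sL sL'; apply/esym/eqP.
  by rewrite eqEdim subv_add sL sL' dS (dim_add_lines dL dL' neqL).
have e1 : side1 T = (vertex12 T + vertex13 T)%VS.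
  by apply: sideE; rewrite ?capvSl//; exact: dim_grassmannian.
have e2 : side2 T = (vertex12 T + vertex23 T)%VS.
  by apply: sideE; rewrite ?capvSl ?capvSr//; exact: dim_grassmannian.
have e3 : side3 T = (vertex13 T + vertex23 T)%VS.
  by apply: sideE; rewrite ?capvSr//; exact: dim_grassmannian.
split=> //; split=> //; rewrite -e1.
have ds1 : \dim (side1 T) = 2%N by exact: dim_grassmannian.
have := dimv_sum_cap (side1 T) (vertex23 T).
suff : \dim (side1 T :&: vertex23 T) != 1%N.
  by have := dimvS (capvSr (side1 T) (vertex23 T)); lia.
(* If [vertex23] were on [side1], it would lie in the intersection of [side1] and [side2], and so
   coincide with [vertex12]. *)
apply/eqP => dc; apply: n2; apply/eqP; rewrite eq_sym eqEdim d12 d23 leqnn andbT.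
have /eqP <- : (side1 T :&: vertex23 T == vertex23 T)%VS.
  by rewrite eqEdim capvSr dc d23.
by rewrite subv_cap capvSl (subv_trans (capvSr _ _)) ?capvSl.
Qed.

Lemma triangle_flag_dim T : \dim (side1 T + side2 T) = 3%N.
Proof.
have [[_ _ _ <-] e1 e2 _] := triangle_vertices T.
by rewrite e2 addvA e1 (addvC _ (vertex12 T)) addvA addvv.
Qed.

Lemma vertex12_dim T : \dim (vertex12 T) = 1%N.
Proof. by have [[]] := triangle_vertices T. Qed.

Lemma flag_of_triangle_subproof T :
  (vertex12 T <= side1 T)%VS /\ (side1 T <= side1 T + side2 T)%VS.
Proof. by rewrite capvSl addvSl. Qed.

(** Using [side1 + side2] for the sum of the three vertices expresses the flag by one intersection
    and one sum of sides. *)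
Definition flag_of_triangle T : flag123 R n.+1 :=
  exist _ (grassmannian_of (vertex12_dim T), (val T).1.1,
           grassmannian_of (triangle_flag_dim T))
    (mem_set (flag_of_triangle_subproof T)).

Definition step1 V : vsp := val (val V).1.1.
Definition step2 V : vsp := val (val V).1.2.
Definition step3 V : vsp := val (val V).2.

Lemma flag_lines V : independent_lines
  (step1 V) (shear 1 (step1 V) (step2 V)) (shear 1 (step2 V) (step3 V)).
Proof.
have [s12 s23] := set_mem (valP V).
by apply: flag_independent_lines => //; exact: dim_grassmannian.
Qed.

Definition triangle_of_flag V := triangle (flag_lines V).

(** The shear parameter is [1 - t]: full Gram-Schmidt at time 0, no change at time 1. As [side1] is
    the sum of the first two vertices, independence persists throughout. *)
Lemma deformed_lines (Tt : line_triples R n * R) : independent_lines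
  (vertex12 Tt.1)
  (shear (1 - Tt.2) (vertex12 Tt.1) (vertex13 Tt.1))
  (shear (1 - Tt.2) (side1 Tt.1) (vertex23 Tt.1)).
Proof.
have [ind -> _ _] := triangle_vertices Tt.1; exact: independent_lines_shear.
Qed.

Definition deformation Tt := triangle (deformed_lines Tt).

Lemma triangle_of_flagK V : flag_of_triangle (triangle_of_flag V) = V.
Proof.
have [s12 s23] := set_mem (valP V).
rewrite -/(step1 V) -/(step2 V) -/(step3 V) in s12 s23.
have e2 : (step1 V + shear 1 (step1 V) (step2 V) = step2 V)%VS.
  by rewrite addv_shear; exact/addv_idPr.
apply: grassmannians_inj => /=.
- exact: independent_lines_cap (flag_lines V).
- exact: e2.
- suff : (step1 V + shear 1 (step1 V) (step2 V) +
          (step1 V + shear 1 (step2 V) (step3 V)) = step3 V)%VS by [].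
  rewrite e2 addvA (addvC _ (step1 V)) (addv_idPr s12) addv_shear.
  exact/addv_idPr.
Qed.

(** A shear with parameter 1 kills the part of a subspace lying in [U], so shearing the flag steps
    gives the same lines as shearing the vertices. *)
Lemma deformation0 T : deformation (T, 0) = triangle_of_flag (flag_of_triangle T).
Proof.
have [_ e1 e2 _] := triangle_vertices T.
have s1 : step1 (flag_of_triangle T) = vertex12 T by [].
have s2 : step2 (flag_of_triangle T) = side1 T by [].
have M2 : shear 1 (vertex12 T) (side1 T) = shear 1 (vertex12 T) (vertex13 T).
  by rewrite [in LHS]e1 shearD shear1_sub// add0v.
have M3 : shear 1 (side1 T) (side1 T + side2 T) = shear 1 (side1 T) (vertex23 T).
  rewrite [in X in shear _ _ (_ + X)]e2 !shearD.
  by rewrite (shear1_sub (subvv _)) (shear1_sub (capvSl _ _)) !add0v.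
by apply: grassmannians_inj => /=; rewrite subr0 ?s1 ?s2 ?M2 ?M3.
Qed.

Lemma deformation1 T : deformation (T, 1) = T.
Proof.
have [_ e1 e2 e3] := triangle_vertices T.
by apply: grassmannians_inj; rewrite /= subrr !shear0 ?e1 ?e2 ?e3.
Qed.

(** * Continuity of both maps and of the deformation *)

Lemma vcontinuous_triangle (X : topologicalType) (L1 L2 L3 : X -> vsp)
    (ind : forall x, independent_lines (L1 x) (L2 x) (L3 x)) :
    vcontinuous L1 -> vcontinuous L2 -> vcontinuous L3 ->
  continuous (fun x => triangle (ind x)).
Proof.
move=> c1 c2 c3; apply: continuous_to_grassmannians.
- apply: (@vcontinuous_add _ _ _ _ _ 2%N) => // x.
  exact: independent_lines_dim2 (ind x).
- apply: (@vcontinuous_add _ _ _ _ _ 2%N) => // x.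
  exact: independent_lines_dim2 (independent_lines_swap23 (ind x)).
- apply: (@vcontinuous_add _ _ _ _ _ 2%N) => // x.
  exact: independent_lines_dim2
    (independent_lines_swap23 (independent_lines_swap12 (ind x))).
Qed.

Lemma vcontinuous_sides :
  [/\ vcontinuous side1, vcontinuous side2 & vcontinuous side3].
Proof. exact: vcontinuous_grassmannians. Qed.

Lemma vcontinuous_vertices :
  [/\ vcontinuous vertex12, vcontinuous vertex13 & vcontinuous vertex23].
Proof.
have [c1 c2 c3] := vcontinuous_sides.
by split; apply: (@vcontinuous_cap _ _ _ _ _ 1%N) => // T;
  have [[]] := triangle_vertices T.
Qed.

Lemma continuous_flag_of_triangle : continuous flag_of_triangle.
Proof.
have [c1 c2 _] := vcontinuous_sides; have [c12 _ _] := vcontinuous_vertices.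
apply: continuous_to_grassmannians => //.
apply: (@vcontinuous_add _ _ _ _ _ 3%N) => // T; exact: triangle_flag_dim.
Qed.

Lemma vcontinuous_steps :
  [/\ vcontinuous step1, vcontinuous step2 & vcontinuous step3].
Proof. exact: vcontinuous_grassmannians. Qed.

Lemma continuous_triangle_of_flag : continuous triangle_of_flag.
Proof.
have [c1 c2 c3] := vcontinuous_steps.
have cst1 : continuous (fun _ : flag123 R n.+1 => 1 : R) by exact: cst_continuous.
apply: vcontinuous_triangle; first exact: c1.
- apply: (@vcontinuous_shear _ _ _ 1%N) => // V.
  by case: (flag_lines V).
- apply: (@vcontinuous_shear _ _ _ 1%N) => // V.
  by case: (flag_lines V).
Qed.

Lemma continuous_deformation : continuous deformation.
Proof.
have [c1 _ _] := vcontinuous_sides; have [c12 c13 c23] := vcontinuous_vertices.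
pose XR : topologicalType := (line_triples R n * R)%type.
have cfst := @continuous_fst (line_triples R n) R.
have cs : continuous (fun Tt : XR => 1 - Tt.2).
  move=> Tt; apply: cvgB; [exact: cvg_cst | exact: continuous_snd].
apply: vcontinuous_triangle; first exact: vcontinuous_comp cfst c12.
- apply: (@vcontinuous_shear _ _ _ 1%N) => //; last by move=> Tt; case: (deformed_lines Tt).
    exact: vcontinuous_comp cfst c12.
  exact: vcontinuous_comp cfst c13.
- apply: (@vcontinuous_shear _ _ _ 1%N) => //; last by move=> Tt; case: (deformed_lines Tt).
    exact: vcontinuous_comp cfst c1.
  exact: vcontinuous_comp cfst c23.
Qed.

End LineTriples.

(** * The homotopy equivalence *)

Theorem theorem5 (R : realType) (n : nat) (n_gt0 : (0 < n)%N) :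
  homotopy_equivalent R (line_triples R n) (flag123 R n.+1).
Proof.
exists (@flag_of_triangle R n), (@triangle_of_flag R n); split.
- exact: continuous_flag_of_triangle.
- exact: continuous_triangle_of_flag.
(* The deformation is continuous for all real times, so its restriction to the unit interval is
   too. *)
- exists (@deformation R n); split; last exact: deformation1.
    exact: continuous_subspaceT (@continuous_deformation R n).
  by move=> T; rewrite deformation0.
(* This composite is equal to the identity, so the constant homotopy suffices. *)
- exists fst; split => [|V|V] //=; last by rewrite triangle_of_flagK.
  exact: continuous_subspaceT (@continuous_fst _ _).
Qed.
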